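(* Let $\mathcal{R}=\begin{pmatrix}\mathcal{P}\\ \mathcal{S}\end{pmatrix}$ be a maximally reciprocal constant-coefficient $2n\times n$ matrix differential operator of order $M$ on $[a,b]$, with polynomial matrix $R(s)$ and boundary polynomial matrix $R_\partial(s)=\begin{pmatrix}P_\partial(s)\\ S_\partial(s)\end{pmatrix}$, and let $\mathcal{J}$ be a formally skew-adjoint constant-coefficient $n\times n$ matrix differential operator of order $N$. Consider the linear boundary port-Hamiltonian system defined by the Stokes-Dirac structure $\mathscr{D}_{\mathcal{J}}$ of $\mathcal{J}$ and the Stokes-Lagrange subspace $\mathcal{L}_{\mathcal{R}}$ of $\mathcal{R}$, i.e. the dynamical system $$\left(\begin{pmatrix}\frac{\partial x}{\partial t}\\ f_\partial\end{pmatrix},\begin{pmatrix}e\\ e_\partial\end{pmatrix}\right)\in\mathscr{D}_{\mathcal{J}}\quad\text{and}\quad\left(\begin{pmatrix}x\\ \chi_\partial\end{pmatrix},\begin{pmatrix}e\\ \varepsilon_\partial\end{pmatrix}\right)\in\mathcal{L}_{\mathcal{R}},$$ so that $x=\mathcal{P}\xi$, $e=\mathcal{S}\xi$ and $\frac{\partial}{\partial t}\mathcal{P}\xi=\mathcal{J}\mathcal{S}\xi$, with power boundary port variables $(f_\partial,e_\partial)$ and energy boundary port variables $(\chi_\partial,\varepsilon_\partial)$. Define the Hamiltonian functional $$\mathfrak{H}(\xi)=\frac12\int_a^b\sum_{i,j=0}^{M}\Big(\frac{\partial^i\xi}{\partial z^i}\Big)^\top H_{ij}\,\frac{\partial^j\xi}{\partial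 z^j}\,dz$$ associated with the two-variable polynomial matrix $$H(\zeta,\eta)=\sum_{i,j=0}^M H_{ij}\zeta^i\eta^j=\frac{R^\top(\zeta)\,\Xi_n\,R(\eta)}{2}-(\zeta+\eta)\,\frac{R_\partial^\top(\zeta)\,\Xi_p\,R_\partial(\eta)}{2}.$$ This Hamiltonian satisfies the balance equation $$\frac{d\mathfrak{H}}{dt}=e_\partial^\top f_\partial-\Big[\varepsilon_\partial^\top\frac{d\chi_\partial}{dt}\Big]_a^b .$$
   Context: Operators: $\mathcal{R}=\sum_{i=0}^M R_i\frac{\partial^i}{\partial z^i}$ with constant $R_i\in\mathbb{R}^{2n\times n}$, with polynomial matrix $R(s)=\sum_iR_is^i=\begin{pmatrix}P(s)\\ S(s)\end{pmatrix}$; $\mathcal{P}=P(\frac{\partial}{\partial z})$, $\mathcal{S}=S(\frac{\partial}{\partial z})$ are $n\times n$ operators. The formal adjoint of $\sum_kA_k\frac{\partial^k}{\partial z^k}$ is $\sum_k(-1)^kA_k^\top\frac{\partial^k}{\partial z^k}$. Notation: $\Theta_m=\begin{pmatrix}0_m&-I_m\\ I_m&0_m\end{pmatrix}$, $\Xi_m=\begin{pmatrix}0_m&I_m\\ I_m&0_m\end{pmatrix}$, $[g]_a^b=g(b)-g(a)$, $\mathrm{tr}(\varphi)=\begin{pmatrix}\varphi(a)\\ \varphi(b)\end{pmatrix}$. Maximally reciprocal: $\mathcal{R}$ is reciprocal if $\mathcal{S}^*\mathcal{P}-\mathcal{P}^*\mathcal{S}=\mathcal{R}^*\Theta_n\mathcal{R}=0$,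 equivalently $S^\top(-s)P(s)-P^\top(-s)S(s)=0$. It is maximally reciprocal if moreover $\operatorname{Im}\mathcal{R}=\ker\mathcal{R}^*\Theta_n$; equivalently, $\operatorname{rank}R(s)=n$ for all $s\in\mathbb{C}$. Boundary polynomial matrix: by reciprocity, $R^\top(\zeta)\Theta_nR(\eta)=(\zeta+\eta)\bar\Psi(\zeta,\eta)$ for a unique two-variable polynomial matrix $\bar\Psi$. $R_\partial(s)$ is a $2p\times n$ polynomial matrix with coefficient matrix of full row rank such that $\bar\Psi(\zeta,\eta)=R_\partial^\top(\zeta)\Theta_pR_\partial(\eta)$. It is split into $p\times n$ blocks $P_\partial$ and $S_\partial$. Stokes-Lagrange subspace and energy boundary port variables: $\mathcal{L}_{\mathcal{R}}$ is the set of $(x,e,\chi_\partial,\varepsilon_\partial)$, with $x,e\in L^2([a,b],\mathbb{R}^n)$, for which there is $\xi\in H^M([a,b],\mathbb{R}^n)$ with $\begin{pmatrix}x\\ e\end{pmatrix}=\mathcal{R}\xi$ and, at each endpoint $z\in\{a,b\}$, $\chi_\partial(z)=\big(P_\partial(\frac{\partial}{\partial z})\xi\big)(z)$ and $\varepsilon_\partial(z)=\big(S_\partial(\frac{\partial}{\partial z})\xi\big)(z)$. Stokes-Dirac structure and power boundary port variables: $\mathcal{J}=\sum_{k=0}^NJ_k\frac{\partial^k}{\partial z^k}$, with $J_k\in\mathbb{R}^{n\times n}$ symmetric for $k$ odd and skew-symmetric for $k$ even; write $\mathcal{J}(s)=\sum_kJ_ks^k$. Then $\mathcal{J}(\eta)+\mathcal{J}^\top(\zeta)=(\zeta+\eta)\Psi(\zeta,\eta)$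 for a symmetric two-variable polynomial matrix $\Psi$ (that is, $\Psi(\zeta,\eta)=\Psi^\top(\eta,\zeta)$). Take a minimal factorization $\Psi(\zeta,\eta)=T(\zeta)^\top\Sigma\,T(\eta)$, with $T(s)$ a $\delta\times n$ polynomial matrix, $\delta$ being the rank of the coefficient matrix of $\Psi$, and $\Sigma=\mathrm{diag}(I_\alpha,-I_\beta)$, $\alpha+\beta=\delta$. $\mathscr{D}_{\mathcal{J}}$ is the set of $\left(\begin{pmatrix}f\\ f_\partial\end{pmatrix},\begin{pmatrix}e\\ e_\partial\end{pmatrix}\right)$, with $f,e\in L^2([a,b],\mathbb{R}^n)$ and $f_\partial,e_\partial\in\mathbb{R}^\delta$, such that $e\in H^N([a,b],\mathbb{R}^n)$, $f=\mathcal{J}e$ and $$\begin{pmatrix}f_\partial\\ e_\partial\end{pmatrix}=\frac1{\sqrt2}\begin{pmatrix}\Sigma&\Sigma\\ \Sigma&-\Sigma\end{pmatrix}\mathrm{tr}\Big(T\big(\tfrac{\partial}{\partial z}\big)e\Big).$$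
   Formalization: The port map of the Stokes-Dirac structure is corrected: its second block row (Σ, −Σ) is replaced by (−I, I), so e_∂ is −Σ times the printed one; with the printed map the balance equation fails, e.g. for n=1, R=(1;1), J=d/dz, Σ=1, ξ=t+z. *)

(* Defs.v *)
From HB Require Import structures.
From mathcomp Require Export all_boot all_order all_algebra.
From mathcomp Require Export all_classical all_reals all_analysis.

Set Implicit Arguments.
Unset Strict Implicit.
Unset Printing Implicit Defensive.

Import Order.TTheory GRing.Theory Num.Theory.
Import numFieldTopology.Exports numFieldNormedType.Exports.

Local Open Scope classical_set_scope.
Local Open Scope ring_scope.

(* A polynomial matrix A(s) = \sum_k A_k s^k has type 'M[{poly R}]_(m, n); a
   two-variable one has type 'M[{poly {poly R}}]_(m, n), where zeta is the
   inner and eta the outer indeterminate. *)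

Section PolynomialMatrices.
Context {R : realType}.

Definition zeta : {poly {poly R}} := 'X%:P.
Definition eta : {poly {poly R}} := 'X.

Definition at_zeta m n (A : 'M[{poly R}]_(m, n)) : 'M[{poly {poly R}}]_(m, n) :=
  map_mx polyC A.

Definition at_eta m n (A : 'M[{poly R}]_(m, n)) : 'M[{poly {poly R}}]_(m, n) :=
  map_mx (map_poly polyC) A.

Definition coefm (k : nat) m n (A : 'M[{poly R}]_(m, n)) : 'M[R]_(m, n) :=
  \matrix_(i, j) (A i j)`_k.

Definition coefm2 (k l : nat) m n (F : 'M[{poly {poly R}}]_(m, n)) :
    'M[R]_(m, n) :=
  \matrix_(i, j) ((F i j)`_l)`_k.

Definition order_le (M : nat) m n (A : 'M[{poly R}]_(m, n)) : Prop :=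
  forall i j, (size (A i j) <= M.+1)%N.

Definition sizem m n (A : 'M[{poly R}]_(m, n)) : nat :=
  \max_(i < m) \max_(j < n) size (A i j).

Definition sizem2 m n (F : 'M[{poly {poly R}}]_(m, n)) : nat :=
  \max_(i < m) \max_(j < n) maxn (size (F i j)) (sizeY (F i j)).

(* Coefficient matrices: (A_0 A_1 ... A_d), and the block matrix of the F_kl. *)
Definition coef_matrix m n (A : 'M[{poly R}]_(m, n)) :=
  \mxrow_(k < sizem A) coefm k A.

Definition coef_matrix2 m n (F : 'M[{poly {poly R}}]_(m, n)) :=
  \mxblock_(k < sizem2 F, l < sizem2 F) coefm2 k l F.

Definition Theta (S : pzRingType) m : 'M[S]_(m + m) :=
  block_mx 0 (- 1%:M) 1%:M 0.

Definition Xi (S : pzRingType) m : 'M[S]_(m + m) :=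
  block_mx 0 1%:M 1%:M 0.

Definition Sig (alpha beta : nat) : 'M[R]_(alpha + beta) :=
  block_mx 1%:M 0 0 (- 1%:M).

Definition formal_adjoint m n (A : 'M[{poly R}]_(m, n)) : 'M[{poly R}]_(n, m) :=
  map_mx (fun q => q \Po (- 'X)) A^T.

Definition skew_adjoint n (J : 'M[{poly R}]_n) : Prop := formal_adjoint J = - J.

Definition reciprocal n (Rm : 'M[{poly R}]_(n + n, n)) : Prop :=
  formal_adjoint Rm *m Theta _ n *m Rm = 0.

(* C^oo([a, b]) is represented by C^oo functions on the whole line, compared
   only on [a, b]; on [a, b] the derivatives do not depend on the extension. *)
Definition smooth n (w : R -> 'cV[R]_n) : Prop :=
  forall i k z, derivable (derive1n k (fun y => w y i 0)) z 1.

Definition smooth_op m n (A : 'M[{poly R}]_(m, n)) (w : R -> 'cV[R]_n) (z : R) :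
    'cV[R]_m :=
  \sum_(k < sizem A) coefm k A *m \col_i derive1n k (fun y => w y i 0) z.

Definition maximally_reciprocal (a b : R) n (Rm : 'M[{poly R}]_(n + n, n)) :
    Prop :=
  reciprocal Rm /\
  forall w : R -> 'cV[R]_(n + n), smooth w ->
    ((exists2 xi : R -> 'cV[R]_n, smooth xi &
        forall z, z \in `[a, b] -> w z = smooth_op Rm xi z) <->
     (forall z, z \in `[a, b] ->
        smooth_op (formal_adjoint Rm *m Theta _ n) w z = 0)).

Definition boundary_polynomial_matrix n p (Rm : 'M[{poly R}]_(n + n, n))
    (Rb : 'M[{poly R}]_(p + p, n)) : Prop :=
  row_free (coef_matrix Rb) /\
  exists Psib : 'M[{poly {poly R}}]_n,
    (at_zeta Rm)^T *m Theta _ n *m at_eta Rm = (zeta + eta) *: Psib /\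
    Psib = (at_zeta Rb)^T *m Theta _ p *m at_eta Rb.

Definition minimal_factorization n alpha beta (J : 'M[{poly R}]_n)
    (T : 'M[{poly R}]_(alpha + beta, n)) : Prop :=
  exists Psi : 'M[{poly {poly R}}]_n,
    [/\ at_eta J + (at_zeta J)^T = (zeta + eta) *: Psi,
        Psi = (at_zeta T)^T *m map_mx (polyC \o polyC) (Sig alpha beta)
                *m at_eta T
      & (alpha + beta)%N = \rank (coef_matrix2 Psi)].

Definition hamiltonian_matrix n p (Rm : 'M[{poly R}]_(n + n, n))
    (Rb : 'M[{poly R}]_(p + p, n)) : 'M[{poly {poly R}}]_n :=
  (2^-1)%:P%:P *: ((at_zeta Rm)^T *m Xi _ n *m at_eta Rm)
  - ((zeta + eta) * (2^-1)%:P%:P) *: ((at_zeta Rb)^T *m Xi _ p *m at_eta Rb).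

End PolynomialMatrices.

Section Spaces.
Context {R : realType}.
Local Notation mu := (@lebesgue_measure R).

Definition in_L2 (a b : R) n (f : R -> 'cV[R]_n) : Prop :=
  forall i, ((fun z => f z i 0) \_ `[a, b]) \in Lfun mu 2%:E.

Definition L2_cvg (a b : R) n (F : set_system R) (u : R -> R -> 'cV[R]_n)
    (f : R -> 'cV[R]_n) : Prop :=
  forall i, Lnorm mu 2%:E (EFin \o ((fun z => u s z i 0 - f z i 0) \_ `[a, b]))
              @[s --> F] --> 0%E.

Definition ae_eq_on (a b : R) n (f g : R -> 'cV[R]_n) : Prop :=
  {ae mu, forall z, z \in `[a, b] -> f z = g z}.

(* [d k], k <= M, are the weak derivatives of [f]: [d k] is absolutely
   continuous for k < M, so that its values at a and b make sense, and [d 0]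
   is the continuous representative of [f] when M > 0. *)
Definition sobolev_jet (a b : R) (M n : nat) (f : R -> 'cV[R]_n)
    (d : nat -> R -> 'cV[R]_n) : Prop :=
  [/\ ae_eq_on a b f (d 0%N),
      forall k, (k <= M)%N -> in_L2 a b (d k)
    & forall k, (k < M)%N -> forall z, z \in `[a, b] -> forall i,
        d k z i 0 = d k a i 0 + \int[mu]_(y in `[a, z]) d k.+1 y i 0].

(* f \in H^M([a, b]) *)
Definition sobolev (a b : R) (M n : nat) (f : R -> 'cV[R]_n) : Prop :=
  exists d, sobolev_jet a b M f d.

(* Weak derivatives of f \in H^M([a, b]): on [a, b] they are uniquely determined
   everywhere for k < M and almost everywhere for k = M. *)
Definition wderiv (a b : R) (M n : nat) (f : R -> 'cV[R]_n) :
    nat -> R -> 'cV[R]_n :=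
  xget (fun _ _ => 0) [set d | sobolev_jet a b M f d].

(* A(d/dz) f for f \in H^M([a, b]) and A of degree at most M. *)
Definition diffop (a b : R) (M m n : nat) (A : 'M[{poly R}]_(m, n))
    (f : R -> 'cV[R]_n) (z : R) : 'cV[R]_m :=
  \sum_(k < M.+1) coefm k A *m wderiv a b M f k z.

Definition tr (a b : R) m (phi : R -> 'cV[R]_m) : 'cV[R]_(m + m) :=
  col_mx (phi a) (phi b).

Definition bracket (a b : R) (g : R -> R) : R := g b - g a.

(* The port map is (1/sqrt 2) (Sig Sig; -1 1). With the block row (Sig -Sig) in
   place of (-1 1), e_d would be replaced by - Sig e_d and e_d^T f_d would be
   (|T e (a)|^2 - |T e (b)|^2) / 2 instead of
   [(T e)^T Sig (T e)]_a^b / 2 = \int_a^b e^T J e. *)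
Definition stokes_dirac (a b : R) (N n alpha beta : nat) (J : 'M[{poly R}]_n)
    (T : 'M[{poly R}]_(alpha + beta, n)) :
    set (((R -> 'cV[R]_n) * 'cV[R]_(alpha + beta)) *
         ((R -> 'cV[R]_n) * 'cV[R]_(alpha + beta))) :=
  [set w | let: ((f, fb), (e, eb)) := w in
    [/\ in_L2 a b f, in_L2 a b e, sobolev a b N e,
        ae_eq_on a b f (diffop a b N J e)
      & col_mx fb eb = (Num.sqrt 2)^-1 *:
          (block_mx (Sig alpha beta) (Sig alpha beta) (- 1%:M) 1%:M
             *m tr a b (diffop a b N T e))]].

(* The energy boundary port variables are functions of the endpoint; only their
   values at a and b are meaningful. *)
Definition stokes_lagrange_latent (a b : R) (M n p : nat)
    (Rm : 'M[{poly R}]_(n + n, n)) (Rb : 'M[{poly R}]_(p + p, n))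
    (xi : R -> 'cV[R]_n)
    (w : ((R -> 'cV[R]_n) * (R -> 'cV[R]_p)) *
         ((R -> 'cV[R]_n) * (R -> 'cV[R]_p))) : Prop :=
  let: ((x, chi), (e, eps)) := w in
  [/\ in_L2 a b x, in_L2 a b e, sobolev a b M xi,
      ae_eq_on a b (fun z => col_mx (x z) (e z)) (diffop a b M Rm xi)
    & forall z, z = a \/ z = b ->
        chi z = diffop a b M (usubmx Rb) xi z /\
        eps z = diffop a b M (dsubmx Rb) xi z].

Definition stokes_lagrange (a b : R) (M n p : nat)
    (Rm : 'M[{poly R}]_(n + n, n)) (Rb : 'M[{poly R}]_(p + p, n)) :
    set (((R -> 'cV[R]_n) * (R -> 'cV[R]_p)) *
         ((R -> 'cV[R]_n) * (R -> 'cV[R]_p))) :=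
  [set w | exists xi, stokes_lagrange_latent a b M Rm Rb xi w].

(* Trajectories on the set of times I. The time derivative of x is taken in
   L^2([a, b]), that of chi pointwise at the endpoints; e and eps are only
   required to be continuous in time. *)
Definition boundary_phs (a b : R) (M N n p alpha beta : nat)
    (Rm : 'M[{poly R}]_(n + n, n)) (Rb : 'M[{poly R}]_(p + p, n))
    (J : 'M[{poly R}]_n) (T : 'M[{poly R}]_(alpha + beta, n)) (I : set R)
    (x e : R -> R -> 'cV[R]_n) (chi eps : R -> R -> 'cV[R]_p)
    (fb eb : R -> 'cV[R]_(alpha + beta)) : Prop :=
  forall t, I t ->
  [/\ exists2 dx : R -> 'cV[R]_n,
        L2_cvg a b 0^' (fun h z => h^-1 *: (x (t + h) z - x t z)) dx &
        stokes_dirac a b N J T ((dx, fb t), (e t, eb t)),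
      stokes_lagrange a b M Rm Rb ((x t, chi t), (e t, eps t)),
      L2_cvg a b (nbhs t) e (e t)
    & forall z, z = a \/ z = b -> forall i,
        derivable (fun s => chi s z i 0) t 1 /\
        {for t, continuous (fun s => eps s z i 0)}].

Definition dtime p (chi : R -> R -> 'cV[R]_p) (t z : R) : 'cV[R]_p :=
  \col_i derive1 (fun s => chi s z i 0) t.

Definition hamiltonian (a b : R) (M n : nat) (H : 'M[{poly {poly R}}]_n)
    (xi : R -> 'cV[R]_n) : R :=
  2^-1 * \int[mu]_(z in `[a, b])
    (\sum_(i < M.+1) \sum_(j < M.+1)
       (wderiv a b M xi i z)^T *m coefm2 i j H *m wderiv a b M xi j z) 0 0.

End Spaces.

(* Main.v *)
(** The bilinear form
    [B(s, s') = \int x_s^T e_s' - [chi_s^T eps_s']_a^b]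
    is symmetric in the times [s] and [s']: integrating
    [R^T(zeta) Theta R(eta) = (zeta + eta) R_d^T(zeta) Theta R_d(eta)] along two
    solutions turns the integral of [e_s^T x_s' - x_s^T e_s'] into boundary terms.
    The same integration by parts, applied to the total derivative in [H], shows
    that the Hamiltonian is [B(s, s) / 2].  By symmetry
    [B(s, s) - B(t, t) = B(s, s) - B(t, s) + B(s, t) - B(t, t)] only involves
    increments of [x] and [chi], so that [e] and [eps] need not be differentiable
    in time, and the derivative is [\int (dx/dt)^T e - [eps^T dchi/dt]_a^b].
    Finally [\int (J e)^T e] is the boundary term [e_d^T f_d], because
    [J(eta) + J^T(zeta) = (zeta + eta) T^T(zeta) Sigma T(eta)]. *)
Require Import Defs.
From mathcomp Require Import measurable_realfun ring lra.

Set Implicit Arguments.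
Unset Strict Implicit.
Unset Printing Implicit Defensive.

Import Order.TTheory GRing.Theory Num.Theory.
Import numFieldTopology.Exports numFieldNormedType.Exports.

Local Open Scope classical_set_scope.
Local Open Scope ring_scope.

(** * Integration by parts for absolutely continuous functions *)

Section Integration.
Context {R : realType}.
Local Notation mu := (@lebesgue_measure R).
Implicit Types f g u v : R -> R.

Lemma measurable_fun_le_pair :
  measurable_fun [set: R * R] (fun p : R * R => (p.2 <= p.1)%R%:R : R).
Proof.
have mE : measurable [set p : R * R | p.2 <= p.1].
  by rewrite -[X in measurable X]setTI; exact: measurable_fun_le.
rewrite (_ : (fun _ => _) = \1_[set p : R * R | p.2 <= p.1]).
  exact: measurable_indic.
apply/funext => p; rewrite indicE; congr (_ %:R).
by rewrite mem_setE.
Qed.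

Lemma integrable_tensor f g :
  mu.-integrable setT (EFin \o f) -> mu.-integrable setT (EFin \o g) ->
  (mu \x mu)%E.-integrable setT (fun p : R * R => (f p.1 * g p.2)%:E).
Proof.
move=> If Ig.
have mf : measurable_fun setT f by apply/measurable_EFinP; exact: (measurable_int _ If).
have mg : measurable_fun setT g by apply/measurable_EFinP; exact: (measurable_int _ Ig).
apply/integrable12ltyP.
  apply/measurable_EFinP/measurable_funM; exact: measurableT_comp.
under eq_integral => x _.
  rewrite (_ : \int[mu]_y _ = `|f x|%:E * \int[mu]_y `|(g y)%:E|)%E; last first.
    rewrite -ge0_integralZl//.
    - by apply: eq_integral => y _; rewrite /= normrM.
    - by apply: measurableT_comp => //; exact: measurableT_comp.
  over.
rewrite ge0_integralZr//.
- by rewrite lte_mul_pinfty ?integral_ge0 ?ge0_fin_numE ?integral_ge0//;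
    [move/integrableP : If => [] |move/integrableP: Ig => [] ].
- by apply: measurableT_comp => //; exact: measurableT_comp.
- exact: integral_ge0.
Qed.

Lemma EFin_Rintegral (D : set R) f : measurable D ->
  mu.-integrable D (EFin \o f) ->
  (\int[mu]_(x in D) f x)%:E = (\int[mu]_(x in D) (f x)%:E)%E.
Proof. by move=> mD If; rewrite /Rintegral fineK//; exact: integrable_fin_num If. Qed.

(** Absolute continuity in integral form: [u'] is a weak derivative, seen only through its
    integrals. Consecutive members of a Sobolev jet are related in this way. *)
Definition antiderivative (a b : R) (u u' : R -> R) : Prop :=
  forall z, z \in `[a, b] -> u z = u a + \int[mu]_(y in `[a, z]) u' y.

(** On the triangle [x < y], integrating [u' x * v' y] over [y] first leaves [u' * (v b - v)], and
    over [x] first leaves [v' * (u - u a)]. Equating the two yields the formula without continuity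
    of [u'] or [v']. *)
Lemma integration_by_parts_antiderivative (a b : R) u v u' v' :
  a <= b ->
  mu.-integrable `[a, b] (EFin \o u') -> mu.-integrable `[a, b] (EFin \o v') ->
  mu.-integrable `[a, b] (EFin \o (u' \* v)) ->
  mu.-integrable `[a, b] (EFin \o (u \* v')) ->
  antiderivative a b u u' -> antiderivative a b v v' ->
  \int[mu]_(z in `[a, b]) (u' z * v z + u z * v' z) = u b * v b - u a * v a.
Proof.
move=> ab Iu' Iv' Iu'v Iuv' uE vE.
have bab : b \in `[a, b] by rewrite in_itv /= lexx ab.
have mD : measurable (`[a, b]%classic : set (measurableTypeR R)) by exact: measurable_itv.
pose U := u' \_ `[a, b]; pose V := v' \_ `[a, b].
have IU : mu.-integrable setT (EFin \o U).
  by rewrite /U -restrict_EFin; exact: (integrable_mkcond _ mD).1.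
have IV : mu.-integrable setT (EFin \o V).
  by rewrite /V -restrict_EFin; exact: (integrable_mkcond _ mD).1.
have Iu'c c : mu.-integrable `[a, b] (EFin \o (fun z => u' z * c)).
  by apply: eq_integrable (integrableZr mD c Iu') => // z _; rewrite /= EFinM.
have Iv'c c : mu.-integrable `[a, b] (EFin \o (fun z => v' z * c)).
  by apply: eq_integrable (integrableZr mD c Iv') => // z _; rewrite /= EFinM.
have Iu'vb : mu.-integrable `[a, b] (EFin \o (fun z => u' z * (v b - v z))).
  apply: eq_integrable (integrableB mD (Iu'c (v b)) Iu'v) => // z _.
  by rewrite /= mulrBr EFinB.
have Iv'ua : mu.-integrable `[a, b] (EFin \o (fun z => v' z * (u z - u a))).
  apply: eq_integrable (integrableB mD Iuv' (Iv'c (u a))) => // z _.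
  by rewrite /= mulrBr EFinB (mulrC (v' z) (u z)).
have IP := integrable_tensor IU IV.
(* [1 - h] is the indicator of the strict triangle [p.1 < p.2]; its sections are the half-open
   intervals []x, b]] and [[a, y[] met below. *)
pose h (p : R * R) : R := (p.2 <= p.1)%R%:R.
have IQ : (mu \x mu)%E.-integrable setT (fun p => (U p.1 * V p.2 * (1 - h p))%:E).
  apply: le_integrable (IP) => //.
    apply/measurable_EFinP/measurable_funM.
      by apply/measurable_EFinP; exact: (measurable_int _ IP).
    by apply: measurable_funB => //; exact: measurable_fun_le_pair.
  move=> p _; rewrite lee_fin normrM ler_piMr//.
  by rewrite /h; case: (p.2 <= p.1); rewrite ?subrr ?subr0 ?normr0 ?normr1.
(* Fubini for [u' v'] on the triangle [a <= x < y <= b]. *)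
have Fub := Fubini IQ.
have sq : (\int[mu]_x \int[mu]_y (U x * V y * (1 - h (x, y)))%:E)%E =
   (\int[mu]_(z in `[a, b]) (u' z * (v b - v z)))%:E.
  rewrite EFin_Rintegral//.
  rewrite [RHS]integral_mkcond; apply: eq_integral => x _.
  rewrite restrict_EFin /= [in RHS]patchE; case: ifPn; last first.
    move=> xD; have Ux0 : U x = 0 by rewrite /U patchE (negbTE xD).
    by under eq_integral do rewrite Ux0 !mul0r; rewrite integral0.
  move=> /[dup] xD; rewrite inE /= => xab.
  have Ix : mu.-integrable `]x, b] (EFin \o v').
    apply: integrableS Iv' => //.
    by move: xab; rewrite in_itv /= => /andP[ax _]; exact: subset_itvr.
  rewrite (_ : v b - v x = \int[mu]_(y in `]x, b]) v' y); last first.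
    move: (xab); rewrite in_itv /= => /andP[ax xb].
    rewrite -(@Rintegral_itvB _ _ (BLeft a) (BRight b) x)// (vE _ xab) (vE _ bab).
    by ring.
  rewrite EFinM EFin_Rintegral// -integralZl//.
  rewrite [RHS]integral_mkcond; apply: eq_integral => y _.
  rewrite /h /U /V !patchE xD !mem_setE !in_itv/=.
  move: xab; rewrite in_itv /= => /andP[ax xb].
  case: (leP y x) => xy /=; first by rewrite subrr mulr0.
  rewrite subr0 mulr1 (le_trans ax (ltW xy)) /=.
  by case: ifPn; rewrite ?mulr0.
have sq' : (\int[mu]_y \int[mu]_x (U x * V y * (1 - h (x, y)))%:E)%E =
   (\int[mu]_(z in `[a, b]) (v' z * (u z - u a)))%:E.
  rewrite EFin_Rintegral//.
  rewrite [RHS]integral_mkcond; apply: eq_integral => y _.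
  rewrite restrict_EFin /= [in RHS]patchE; case: ifPn; last first.
    move=> yD; have Vy0 : V y = 0 by rewrite /V patchE (negbTE yD).
    by under eq_integral do rewrite Vy0 mulr0 mul0r; rewrite integral0.
  move=> /[dup] yD; rewrite inE /= => yab.
  have Iy : mu.-integrable `[a, y[ (EFin \o u').
    apply: integrableS Iu' => //.
    by move: yab; rewrite in_itv /= => /andP[_ yb]; exact: subset_itvl.
  rewrite (_ : u y - u a = \int[mu]_(x in `[a, y[) u' x); last first.
    by rewrite (uE _ yab) Rintegral_itv_bndo_bndc//; ring.
  rewrite EFinM EFin_Rintegral// -integralZl//.
  rewrite [RHS]integral_mkcond; apply: eq_integral => x _.
  rewrite /h /U /V !patchE yD !mem_setE !in_itv/=.
  move: yab; rewrite in_itv /= => /andP[ay yb].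
  case: (leP y x) => xy /=; first by rewrite subrr mulr0 andbF.
  rewrite subr0 mulr1 (le_trans (ltW xy) yb) andbT.
  by case: ifPn; rewrite ?mul0r// mulrC.
move: Fub; rewrite /= sq sq' => -[].
have -> : \int[mu]_(z in `[a, b]) (u' z * (v b - v z)) =
    (u b - u a) * v b - \int[mu]_(z in `[a, b]) (u' z * v z).
  under eq_Rintegral do rewrite mulrBr.
  rewrite RintegralB// ?RintegralZr//; first by rewrite uE//; ring.
have -> : \int[mu]_(z in `[a, b]) (v' z * (u z - u a)) =
    \int[mu]_(z in `[a, b]) (u z * v' z) - (v b - v a) * u a.
  under eq_Rintegral do rewrite mulrBr (mulrC _ (u _)).
  rewrite RintegralB// ?RintegralZr//; first by rewrite vE//; ring.
rewrite RintegralD// => E; nra.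
Qed.
End Integration.

(** * The inner product of square-integrable functions on the interval *)

Section L2.
Context {R : realType} (a b : R).
Local Notation mu := (@lebesgue_measure R).
Implicit Types f g u v : R -> R.

(** Componentwise, [in_L2] unfolds to this predicate and [L2_cvg] to the convergence of [norm2] to
    zero. *)
Definition L2 f : Prop := f \_ `[a, b] \in Lfun mu 2%:E.
Definition norm2 f : \bar R := Lnorm mu 2%:E (EFin \o f \_ `[a, b]).
Definition ip f g : R := \int[mu]_(z in `[a, b]) (f z * g z).

Lemma restrictM f g : (f \* g) \_ `[a, b] = f \_ `[a, b] \* g \_ `[a, b].
Proof. by apply/funext => z; rewrite /= !patchE; case: ifPn; rewrite ?mulr0. Qed.

Lemma L2_measurable f : L2 f -> measurable_fun setT (f \_ `[a, b]).
Proof. by rewrite /L2 inE => /andP[]; rewrite inE. Qed.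

Lemma L2_norm2_fin f : L2 f -> norm2 f \is a fin_num.
Proof.
rewrite /L2 inE => /andP[_]; rewrite inE /= => ?.
by rewrite ge0_fin_numE// Lnorm_ge0.
Qed.

Lemma integrable_patch f : mu.-integrable `[a, b] (EFin \o f) <->
  mu.-integrable setT (EFin \o (f \_ `[a, b])).
Proof.
rewrite -restrict_EFin.
have mD : measurable (`[a, b]%classic : set (measurableTypeR R)).
  exact: measurable_itv.
by split; [move/(integrable_mkcond _ mD)|move=> ?; exact/(integrable_mkcond _ mD)].
Qed.

Lemma L2M_integrable f g : L2 f -> L2 g ->
  mu.-integrable `[a, b] (EFin \o (f \* g)).
Proof.
move=> f2 g2; apply/integrable_patch; rewrite restrictM.
by apply/Lfun1_integrable; exact: Lfun2_mul_Lfun1.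
Qed.

Lemma L2_cst c : L2 (cst c).
Proof.
rewrite /L2 inE; apply/andP; split; rewrite inE /=.
  have mD : measurable (`[a, b]%classic : set (measurableTypeR R)) by exact: measurable_itv.
  by apply: (measurable_restrictT (cst c) mD).1; exact: measurable_cst.
rewrite /finite_norm unlock poweR_lty//.
rewrite (_ : (fun _ => _) =
  (fun x => (`|c| `^ 2)%:E) \_ `[a, b]); last first.
  apply/funext => x; rewrite /= !patchE; case: ifPn => // _.
  by rewrite normr0 powR0.
rewrite -integral_mkcond integral_cst//= lebesgue_measure_itv/=.
by case: ifPn => _; rewrite ?mule0// -EFinM ltry.
Qed.

(** The interval is bounded, so the constant 1 is square-integrable and can serve as second
    factor. *)
Lemma L2_integrable f : L2 f -> mu.-integrable `[a, b] (EFin \o f).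
Proof.
move=> f2; apply: eq_integrable (L2M_integrable f2 (L2_cst 1)) => // z _.
by rewrite /= mulr1.
Qed.

Lemma L2D f g : L2 f -> L2 g -> L2 (fun z => f z + g z).
Proof.
move=> f2 g2; have [_ /(_ _ _ f2 g2)] := Lfun_addr_closed mu (lee1n 2).
suff -> : f \_ `[a, b] + g \_ `[a, b] = (fun z => f z + g z) \_ `[a, b] by [].
apply/funext => z; rewrite fctE !patchE; case: ifPn => // _; exact: addr0.
Qed.

Lemma L2Z c f : L2 f -> L2 (fun z => c * f z).
Proof.
move=> f2; have := Lfun_scale c (ler1n _ 2) f2.
suff -> : c \o* f \_ `[a, b] = (fun z => c * f z) \_ `[a, b] by [].
apply/funext => z; rewrite [LHS]/= !patchE.
by case: ifPn; rewrite ?mul0r// mulrC.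
Qed.

Lemma L2B f g : L2 f -> L2 g -> L2 (fun z => f z - g z).
Proof.
move=> f2 g2; have := L2D f2 (L2Z (-1) g2).
by under eq_fun do rewrite mulN1r.
Qed.

Lemma L2_sum (I : Type) (s : seq I) (P : pred I) (F : I -> R -> R) :
  (forall i, P i -> L2 (F i)) -> L2 (fun z => \sum_(i <- s | P i) F i z).
Proof.
move=> F2; elim: s => [|i s IH].
  rewrite (_ : (fun _ => _) = cst 0); first exact: L2_cst.
  by apply/funext => z; rewrite big_nil.
have [Pi|Pi] := boolP (P i); last first.
  by under eq_fun do rewrite big_cons (negbTE Pi).
under eq_fun do rewrite big_cons Pi.
exact: L2D (F2 _ Pi) IH.
Qed.

Lemma cauchy_schwarz f g : L2 f -> L2 g ->
  `|ip f g| <= fine (norm2 f) * fine (norm2 g).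
Proof.
move=> f2 g2; rewrite -lee_fin EFinM !fineK ?L2_norm2_fin//.
apply: (@le_trans _ _ (Lnorm mu 1 (EFin \o (f \_ `[a, b] \* g \_ `[a, b]))));
  last first.
  apply: hoelder; rewrite ?ltr0n//; [exact: L2_measurable..|].
  by rewrite [RHS]splitr !div1r.
rewrite EFin_normr_Rintegral//; last exact: L2M_integrable.
rewrite Lnorm1 -restrictM -restrict_EFin.
rewrite integral_mkcond; apply: le_abse_integral => //.
rewrite restrict_EFin restrictM; apply/measurable_EFinP.
by apply: measurable_funM; exact: L2_measurable.
Qed.

Lemma ipC f g : ip f g = ip g f.
Proof. by rewrite /ip; under eq_Rintegral do rewrite mulrC. Qed.

Lemma ipZl c f g : L2 f -> L2 g -> ip (fun z => c * f z) g = c * ip f g.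
Proof.
move=> f2 g2; rewrite /ip; under eq_Rintegral do rewrite -mulrA.
by rewrite RintegralZl//; exact: L2M_integrable.
Qed.

Lemma ipBl f g h : L2 f -> L2 g -> L2 h ->
  ip (fun z => f z - g z) h = ip f h - ip g h.
Proof.
move=> f2 g2 h2; rewrite /ip; under eq_Rintegral do rewrite mulrBl.
by rewrite RintegralB//; exact: L2M_integrable.
Qed.

(** Joint continuity of the inner product. The filter is arbitrary, so that difference quotients
    along a punctured neighbourhood are covered. *)
Lemma cvg_ip (T : Type) (F : set_system T) (FF : Filter F)
    (u_ v_ : T -> R -> R) u v :
  L2 u -> L2 v ->
  (\forall s \near F, L2 (u_ s)) -> (\forall s \near F, L2 (v_ s)) ->
  norm2 (fun z => u_ s z - u z) @[s --> F] --> 0%E ->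
  norm2 (fun z => v_ s z - v z) @[s --> F] --> 0%E ->
  ip (u_ s) (v_ s) @[s --> F] --> ip u v.
Proof.
move=> u2 v2 u_2 v_2 /fine_cvg Nu /fine_cvg Nv.
pose nu s := fine (norm2 (fun z => u_ s z - u z)).
pose nv s := fine (norm2 (fun z => v_ s z - v z)).
suff N0 : `|ip (u_ s) (v_ s) - ip u v| @[s --> F] --> (0 : R).
  by apply/subr_cvg0; exact: norm_cvg0.
(* Cauchy-Schwarz bound for the three terms obtained by expanding both factors around [u] and
   [v]. *)
pose B s := nu s * nv s + nu s * fine (norm2 v) + fine (norm2 u) * nv s.
apply: (squeeze_cvgr (f := fun=> 0) (h := B)); rewrite /=.
- near=> s; rewrite normr_ge0 /=.
  have us : L2 (u_ s) by near: s.
  have vs : L2 (v_ s) by near: s.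
  have -> : ip (u_ s) (v_ s) - ip u v =
    ip (fun z => u_ s z - u z) (fun z => v_ s z - v z) +
    ip (fun z => u_ s z - u z) v + ip u (fun z => v_ s z - v z).
    rewrite !(ipBl us u2)//; last exact: L2B.
    rewrite !(ipC _ (fun z => v_ s z - v z)) !ipBl// !(ipC v) !(ipC (v_ s)).
    by ring.
  do 2 (try (apply: (le_trans (ler_normD _ _)); apply: lerD));
    by apply: cauchy_schwarz => //; exact: L2B.
- exact: cvg_cst.
- rewrite (_ : 0 = 0 * 0 + 0 * fine (norm2 v) + fine (norm2 u) * 0); last by ring.
  apply: cvgD; [apply: cvgD|].
  + exact: cvgM.
  + by apply: cvgM => //; exact: cvg_cst.
  + by apply: cvgM => //; exact: cvg_cst.
Unshelve. all: by end_near.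
Qed.
End L2.

(** * Coefficients of two-variable polynomial matrices and their bilinear differential forms *)

Section BilinearDifferentialForms.
Context {R : realType}.

Lemma coefm2B k l m n (F G : 'M[{poly {poly R}}]_(m, n)) :
  coefm2 k l (F - G) = coefm2 k l F - coefm2 k l G.
Proof. by apply/matrixP => i j; rewrite !mxE !coefB. Qed.

Lemma coefm2D k l m n (F G : 'M[{poly {poly R}}]_(m, n)) :
  coefm2 k l (F + G) = coefm2 k l F + coefm2 k l G.
Proof. by apply/matrixP => i j; rewrite !mxE !coefD. Qed.

Lemma coefm2Z k l m n (c : R) (F : 'M[{poly {poly R}}]_(m, n)) :
  coefm2 k l (c%:P%:P *: F) = c *: coefm2 k l F.
Proof. by apply/matrixP => i j; rewrite !mxE !coefCM. Qed.

(** Every form of the proof is brought to the shape [A^T(zeta) W B(eta)] with constant [W], so that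
    its coefficients are products of one-variable coefficients. *)
Lemma coefm2_congr k l m m' n n' (A : 'M[{poly R}]_(m, n)) (W : 'M[R]_(m, m'))
    (B : 'M[{poly R}]_(m', n')) :
  coefm2 k l ((at_zeta A)^T *m map_mx (polyC \o polyC) W *m at_eta B)
  = (coefm k A)^T *m W *m coefm l B.
Proof.
apply/matrixP => i j; rewrite !mxE !coef_sum; apply: eq_bigr => r _.
(* As [zeta] is the inner variable, an entry of [A^T(zeta) W] is a constant for the outer one, and
   taking the coefficient of [eta^l] only affects [B]. *)
rewrite !mxE (_ : \sum_(_ < m) _ = (\sum_(q < m) A q i * (W q r)%:P)%:P).
  rewrite coefCM coef_map coefMC coef_sum; congr (_ * _).
  by apply: eq_bigr => q _; rewrite !mxE coefMC.
rewrite rmorph_sum; apply: eq_bigr => q _.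
by rewrite !mxE /= polyCM.
Qed.

Lemma coefm2_zetaDeta k l m n (G : 'M[{poly {poly R}}]_(m, n)) :
  coefm2 k l ((zeta + eta) *: G) =
  (if k is k'.+1 then coefm2 k' l G else 0) +
  (if l is l'.+1 then coefm2 k l' G else 0).
Proof.
apply/matrixP => i j; rewrite !mxE /zeta /eta mulrDl !coefD coefCM coefXM coefXM.
by case: k l => [|k] [|l]; rewrite !mxE ?coef0.
Qed.

(* The coefficient at [zeta^(k+1) eta^(l+1)] of the product shows that the entries
   of [G] on an antidiagonal agree up to sign, down to [G_(0, k + l + 1) = 0]. *)
Lemma coefm2_quotient_eq0 (M : nat) m n (G : 'M[{poly {poly R}}]_(m, n)) :
  (forall k l, (M < l)%N -> coefm2 k l ((zeta + eta) *: G) = 0) ->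
  forall k l, (M <= l)%N -> coefm2 k l G = 0.
Proof.
move=> F0; elim=> [|k IH] l Ml.
  by have := F0 0%N l.+1; rewrite coefm2_zetaDeta add0r; exact.
have := F0 k.+1 l.+1; rewrite coefm2_zetaDeta (IH l.+1) ?add0r; first exact.
exact: leqW.
Qed.

Lemma row_free_trmul_eq0 (F : fieldType) m n q (A : 'M[F]_(m, n)) (B : 'M[F]_(m, q)) :
  row_free A -> A^T *m B = 0 -> B = 0.
Proof.
move=> fA /(congr1 trmx); rewrite trmx_mul trmxK trmx0 => /eqP.
by rewrite mulmx_free_eq0// => /eqP/(congr1 trmx); rewrite trmxK trmx0.
Qed.

(** The operator acts on a family [d] of prospective derivatives. For [K = M.+1] and
    [d = wderiv a b M f] it is convertible to [diffop]. *)
Definition jet_op (K : nat) m n (A : 'M[{poly R}]_(m, n)) (d : nat -> R -> 'cV[R]_n)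
    (z : R) : 'cV[R]_m :=
  \sum_(k < K) coefm k A *m d k z.

Lemma usub_jet_op K m1 m2 n (A : 'M[{poly R}]_(m1 + m2, n)) d z :
  usubmx (jet_op K A d z) = jet_op K (usubmx A) d z.
Proof.
rewrite /jet_op (raddf_sum usubmx); apply: eq_bigr => k _; rewrite /= -mul_usub_mx.
by congr (_ *m _); apply/matrixP => i j; rewrite !mxE.
Qed.

Lemma dsub_jet_op K m1 m2 n (A : 'M[{poly R}]_(m1 + m2, n)) d z :
  dsubmx (jet_op K A d z) = jet_op K (dsubmx A) d z.
Proof.
rewrite /jet_op (raddf_sum dsubmx); apply: eq_bigr => k _; rewrite /= -mul_dsub_mx.
by congr (_ *m _); apply/matrixP => i j; rewrite !mxE.
Qed.

(** The bilinear differential form induced by [F], truncated to derivatives of order below [K]. *)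
Definition bdf (K : nat) n (F : 'M[{poly {poly R}}]_n)
    (d1 d2 : nat -> R -> 'cV[R]_n) (z : R) : R :=
  \sum_(k < K) \sum_(l < K) ((d1 k z)^T *m coefm2 k l F *m d2 l z) 0 0.

Lemma bdf_congr K m m' n (A : 'M[{poly R}]_(m, n)) (W : 'M[R]_(m, m'))
    (B : 'M[{poly R}]_(m', n)) d1 d2 z :
  bdf K ((at_zeta A)^T *m map_mx (polyC \o polyC) W *m at_eta B) d1 d2 z =
  ((jet_op K A d1 z)^T *m W *m jet_op K B d2 z) 0 0.
Proof.
rewrite /jet_op /bdf (raddf_sum trmx) /= !mulmx_suml summxE; apply: eq_bigr => k _.
rewrite mulmx_sumr summxE; apply: eq_bigr => l _.
by rewrite coefm2_congr trmx_mul !mulmxA.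
Qed.

Lemma bdfB K n (F G : 'M[{poly {poly R}}]_n) d1 d2 z :
  bdf K (F - G) d1 d2 z = bdf K F d1 d2 z - bdf K G d1 d2 z.
Proof.
rewrite /bdf -sumrB; apply: eq_bigr => k _; rewrite -sumrB; apply: eq_bigr => l _.
by rewrite coefm2B mulmxBr mulmxBl !mxE.
Qed.

Lemma bdfD K n (F G : 'M[{poly {poly R}}]_n) d1 d2 z :
  bdf K (F + G) d1 d2 z = bdf K F d1 d2 z + bdf K G d1 d2 z.
Proof.
rewrite /bdf -big_split; apply: eq_bigr => k _.
rewrite -big_split; apply: eq_bigr => l _.
by rewrite coefm2D mulmxDr mulmxDl !mxE.
Qed.

Lemma bdfZ K n (c : R) (F : 'M[{poly {poly R}}]_n) d1 d2 z :
  bdf K (c%:P%:P *: F) d1 d2 z = c * bdf K F d1 d2 z.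
Proof.
rewrite /bdf mulr_sumr; apply: eq_bigr => k _; rewrite mulr_sumr; apply: eq_bigr => l _.
by rewrite coefm2Z -scalemxAr -scalemxAl mxE.
Qed.

(** Multiplication by [zeta + eta] is the total derivative, expanded here by the product rule. The
    vanishing of [G] from degree [M] on keeps all derivatives at order at most [M]. *)
Lemma bdf_zetaDeta M n (G : 'M[{poly {poly R}}]_n) d1 d2 z :
  (forall k l, (M <= l)%N -> coefm2 k l G = 0) ->
  (forall k l, (M <= k)%N -> coefm2 k l G = 0) ->
  bdf M.+1 ((zeta + eta) *: G) d1 d2 z =
  \sum_(k < M) \sum_(l < M) (((d1 k.+1 z)^T *m coefm2 k l G *m d2 l z) 0 0 +
                            ((d1 k z)^T *m coefm2 k l G *m d2 l.+1 z) 0 0).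
Proof.
move=> Gl Gk; rewrite /bdf.
under eq_bigr => k _.
  under eq_bigr => l _ do rewrite coefm2_zetaDeta mulmxDr mulmxDl mxE.
  rewrite big_split /=; over.
rewrite big_split /=.
(* The [zeta] terms lose [k = 0] and the [eta] terms lose [k = M], after which both sums run over
   [k < M]; the same is then done for [l], with the roles of first and last index unchanged. *)
rewrite big_ord_recl /= [X in X + _ + _]big1 ?add0r; last first.
  by move=> l _; rewrite mulmx0 mul0mx mxE.
rewrite [X in _ + X]big_ord_recr /= [X in _ + (_ + X)]big1 ?addr0; last first.
  move=> l _; case: (l : nat) => [|l']; first by rewrite mulmx0 mul0mx mxE.
  by rewrite Gk// mulmx0 mul0mx mxE.
rewrite -big_split /=; apply: eq_bigr => k _; rewrite big_split /=; congr (_ + _).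
  by rewrite big_ord_recr /= Gl// mulmx0 mul0mx mxE addr0.
by rewrite big_ord_recl /= mulmx0 mul0mx mxE add0r.
Qed.

End BilinearDifferentialForms.

(** * Integrals of total derivatives along Sobolev jets *)

Section IntegralsOfForms.
Context {R : realType} (a b : R).
Local Notation mu := (@lebesgue_measure R).

(** Integrability is carried along with the value because linearity of the integral depends on
    it. *)
Definition has_integral (f : R -> R) (r : R) : Prop :=
  mu.-integrable `[a, b] (EFin \o f) /\ \int[mu]_(z in `[a, b]) f z = r.

Lemma has_integral0 : has_integral (fun=> 0) 0.
Proof.
split; last by rewrite Rintegral_cst// mul0r.
exact: L2_integrable (L2_cst a b 0).
Qed.

Lemma has_integralD f g r s : has_integral f r -> has_integral g s ->
  has_integral (fun z => f z + g z) (r + s).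
Proof.
move=> [If <-] [Ig <-]; split; last by rewrite RintegralD.
by apply: eq_integrable (integrableD _ If Ig) => // z _; rewrite /= EFinD.
Qed.

Lemma has_integralZ c f r : has_integral f r -> has_integral (fun z => c * f z) (c * r).
Proof.
move=> [If <-]; split; last by rewrite RintegralZl.
by apply: eq_integrable (integrableZl _ c If) => // z _; rewrite /= EFinM.
Qed.

Lemma eq_has_integral f g r : f =1 g -> has_integral f r -> has_integral g r.
Proof. by move=> /funext ->. Qed.

Lemma has_integralB f g r s : has_integral f r -> has_integral g s ->
  has_integral (fun z => f z - g z) (r - s).
Proof.
move=> fr /(has_integralZ (-1)) /(has_integralD fr); rewrite mulN1r.
by under eq_fun do rewrite mulN1r.
Qed.

Lemma has_integral_sum (I : Type) (s : seq I) (F : I -> R -> R) (r : I -> R) :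
  (forall i, has_integral (F i) (r i)) ->
  has_integral (fun z => \sum_(i <- s) F i z) (\sum_(i <- s) r i).
Proof.
move=> Fr; elim: s => [|i s IH].
  by rewrite big_nil; under eq_fun do rewrite big_nil; exact: has_integral0.
rewrite big_cons; under eq_fun do rewrite big_cons.
exact: has_integralD.
Qed.

(** What remains of [sobolev_jet] when the represented function is forgotten. *)
Definition is_jet (M n : nat) (d : nat -> R -> 'cV[R]_n) : Prop :=
  (forall k, (k <= M)%N -> forall i, L2 a b (fun z => d k z i 0)) /\
  (forall k, (k < M)%N -> forall i,
     antiderivative a b (fun z => d k z i 0) (fun z => d k.+1 z i 0)).

Lemma sobolev_jet_is_jet M n f (d : nat -> R -> 'cV[R]_n) :
  sobolev_jet a b M f d -> is_jet M d.
Proof. by move=> [_ L A]; split => [k kM i|k kM i z zab]; [exact: L|exact: A]. Qed.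

Lemma L2_jet_op M m n (A : 'M[{poly R}]_(m, n)) d i :
  is_jet M d -> L2 a b (fun z => jet_op M.+1 A d z i 0).
Proof.
move=> [dL _].
under eq_fun do rewrite summxE.
apply: L2_sum => k _; under eq_fun do rewrite mxE.
by apply: L2_sum => j _; apply: L2Z; exact: dL (ltn_ord k) _.
Qed.

Lemma mul_row_mx_colE n (u v : 'cV[R]_n) (A : 'M[R]_n) :
  (u^T *m A *m v) 0 0 = \sum_i \sum_j A i j * (u i 0 * v j 0).
Proof.
rewrite mxE; under eq_bigr do rewrite mxE mulr_suml.
rewrite exchange_big; apply: eq_bigr => i _; apply: eq_bigr => j _.
by rewrite !mxE; ring.
Qed.

(** Integration by parts, one pair of jet entries at a time. As [G] vanishes from degree [M] on, the
    endpoint values only involve derivatives of order below [M], which are absolutely continuous. *)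
Lemma has_integral_bdf M n (G : 'M[{poly {poly R}}]_n) d1 d2 :
  a <= b -> is_jet M d1 -> is_jet M d2 ->
  (forall k l, (M <= l)%N -> coefm2 k l G = 0) ->
  (forall k l, (M <= k)%N -> coefm2 k l G = 0) ->
  has_integral (bdf M.+1 ((zeta + eta) *: G) d1 d2)
    (bdf M.+1 G d1 d2 b - bdf M.+1 G d1 d2 a).
Proof.
move=> ab [d1L d1A] [d2L d2A] Gl Gk.
have bdfM z : bdf M.+1 G d1 d2 z =
    \sum_(k < M) \sum_(l < M) ((d1 k z)^T *m coefm2 k l G *m d2 l z) 0 0.
  rewrite /bdf big_ord_recr /= [X in _ + X]big1 ?addr0; last first.
    by move=> l _; rewrite Gk// mulmx0 mul0mx mxE.
  apply: eq_bigr => k _; rewrite big_ord_recr /=.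
  by rewrite Gl// mulmx0 mul0mx mxE addr0.
rewrite !bdfM -sumrB (_ : bdf _ _ _ _ = fun z =>
  \sum_(k < M) \sum_(l < M) (((d1 k.+1 z)^T *m coefm2 k l G *m d2 l z) 0 0 +
                            ((d1 k z)^T *m coefm2 k l G *m d2 l.+1 z) 0 0)); last first.
  by apply/funext => z; rewrite bdf_zetaDeta.
apply: has_integral_sum => k; rewrite -sumrB; apply: has_integral_sum => l.
under eq_fun do rewrite !mul_row_mx_colE -big_split.
rewrite !mul_row_mx_colE -sumrB; apply: has_integral_sum => i.
under eq_fun do rewrite -big_split.
rewrite -sumrB; apply: has_integral_sum => j /=.
under eq_fun do rewrite -mulrDr.
rewrite -mulrBr; apply: has_integralZ.
have d1L0 := d1L _ (ltnW (ltn_ord k)) i; have d1L1 := d1L _ (ltn_ord k) i.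
have d2L0 := d2L _ (ltnW (ltn_ord l)) j; have d2L1 := d2L _ (ltn_ord l) j.
have I1 := L2M_integrable d1L1 d2L0; have I2 := L2M_integrable d1L0 d2L1.
split.
  by apply: eq_integrable (integrableD _ I1 I2) => // z _; rewrite /= EFinD.
apply: integration_by_parts_antiderivative => //.
- exact: L2_integrable.
- exact: L2_integrable.
- exact: d1A.
- exact: d2A.
Qed.

Definition ipv n (f g : R -> 'cV[R]_n) : R :=
  \sum_i ip a b (fun z => f z i 0) (fun z => g z i 0).

Lemma has_integral_ipv n (f g : R -> 'cV[R]_n) :
  in_L2 a b f -> in_L2 a b g ->
  has_integral (fun z => ((f z)^T *m g z) 0 0) (ipv f g).
Proof.
move=> fL gL.
under eq_fun do rewrite mxE.
apply: has_integral_sum => i.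
under eq_fun do rewrite mxE.
by split => //; exact: L2M_integrable (fL i) (gL i).
Qed.

Lemma ipv_ae n (f g f' g' : R -> 'cV[R]_n) :
  in_L2 a b f -> in_L2 a b g -> in_L2 a b f' -> in_L2 a b g' ->
  ae_eq_on a b f f' -> ae_eq_on a b g g' -> ipv f g = ipv f' g'.
Proof.
move=> fL gL f'L g'L ff' gg'; apply: eq_bigr => i _; congr fine.
apply: ae_eq_integral => //.
- exact: measurable_int (L2M_integrable (fL i) (gL i)).
- exact: measurable_int (L2M_integrable (f'L i) (g'L i)).
- apply: (@filterS2 _ _ (ae_filter_ringOfSetsType mu) _ _ _ _ ff' gg').
  by move=> z fz gz zab; rewrite fz ?gz.
Qed.

Lemma ipvC n (f g : R -> 'cV[R]_n) : ipv f g = ipv g f.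
Proof. by apply: eq_bigr => i _; exact: ipC. Qed.

Lemma has_integral_unique f r s : has_integral f r -> has_integral f s -> r = s.
Proof. by move=> [_ <-] [_ <-]. Qed.
End IntegralsOfForms.

(** * Degree bounds for the boundary operators *)

Section Orders.
Context {R : realType}.

Definition dot n (u v : 'cV[R]_n) : R := (u^T *m v) 0 0.

Lemma dotC n (u v : 'cV[R]_n) : dot u v = dot v u.
Proof. by rewrite /dot !mxE; apply: eq_bigr => i _; rewrite !mxE mulrC. Qed.

Lemma map_Theta n : map_mx (polyC \o polyC) (Theta R n) = Theta {poly {poly R}} n.
Proof. by rewrite /Theta map_block_mx !map_mx0 map_mxN map_mx1. Qed.

Lemma map_Xi n : map_mx (polyC \o polyC) (Xi R n) = Xi {poly {poly R}} n.
Proof. by rewrite /Xi map_block_mx !map_mx0 map_mx1. Qed.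

Lemma Theta_form n (w1 w2 : 'cV[R]_(n + n)) : (w1^T *m Theta R n *m w2) 0 0 =
  dot (dsubmx w1) (usubmx w2) - dot (usubmx w1) (dsubmx w2).
Proof.
rewrite -[w1 in LHS]vsubmxK -[w2 in LHS]vsubmxK tr_col_mx mul_row_block mul_row_col.
by rewrite !mulmx0 add0r addr0 mulmxN !mulmx1 mulNmx /dot !mxE.
Qed.

Lemma Xi_form n (w1 w2 : 'cV[R]_(n + n)) : (w1^T *m Xi R n *m w2) 0 0 =
  dot (dsubmx w1) (usubmx w2) + dot (usubmx w1) (dsubmx w2).
Proof.
rewrite -[w1 in LHS]vsubmxK -[w2 in LHS]vsubmxK tr_col_mx mul_row_block mul_row_col.
by rewrite !mulmx0 add0r addr0 !mulmx1 /dot !mxE.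
Qed.

(** [Theta] squares to minus the identity. *)
Lemma Theta_injective n q (A : 'M[R]_(n + n, q)) : Theta R n *m A = 0 -> A = 0.
Proof.
move=> /(congr1 (mulmx (Theta R n))); rewrite mulmx0 mulmxA /Theta mulmx_block.
rewrite !mulmx0 !mul0mx !mulmx1 !mul1mx !(addr0, add0r).
(* The zero blocks are written as [- 0] to recognise the opposite of the identity. *)
rewrite -[X in block_mx _ X _ _ *m _]oppr0 -[X in block_mx _ _ X _ *m _]oppr0.
by rewrite -opp_block_mx -scalar_mx_block mulNmx mul1mx => /eqP; rewrite oppr_eq0 => /eqP.
Qed.

Lemma Sig_injective alpha beta q (A : 'M[R]_(alpha + beta, q)) :
  Sig alpha beta *m A = 0 -> A = 0.
Proof.
move=> /(congr1 (mulmx (Sig alpha beta))); rewrite mulmx0 mulmxA /Sig mulmx_block.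
rewrite !mulmx0 !mul0mx !(addr0, add0r) mulNmx !mul1mx opprK.
by rewrite -scalar_mx_block mul1mx.
Qed.

Lemma coefm_order M m n (A : 'M[{poly R}]_(m, n)) k :
  order_le M A -> (M < k)%N -> coefm k A = 0.
Proof.
move=> oA Mk; apply/matrixP => i j; rewrite !mxE nth_default//.
exact: leq_trans (oA i j) Mk.
Qed.

(** The length [K] is left free: the row stops at the size of [Rb] in one use and at the size of
    [Psi] in the other. *)
Lemma row_free_coefm_eq0 K m n q (A : 'M[{poly R}]_(m, n)) (B : 'M[R]_(m, q)) :
  row_free (\mxrow_(k < K) coefm k A) ->
  (forall k, (k < K)%N -> (coefm k A)^T *m B = 0) -> B = 0.
Proof.
move=> fA AB; apply: (row_free_trmul_eq0 fA); rewrite tr_mxrow mxcol_mul.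
transitivity (\mxcol_(i < K) (0 : 'M[R]_(n, q))); last exact: mxcol0.
by apply: eq_mxcol => k; rewrite AB.
Qed.

(** Dividing by [zeta + eta] lowers the degree by one. Hence the energy ports only use derivatives
    of order below [M], which have traces at the endpoints. *)
Lemma boundary_polynomial_matrix_order M n p (Rm : 'M[{poly R}]_(n + n, n))
    (Rb : 'M[{poly R}]_(p + p, n)) :
  order_le M Rm -> boundary_polynomial_matrix Rm Rb ->
  forall k, (M <= k)%N -> coefm k Rb = 0.
Proof.
move=> oR [fR [Psi [PsiE PsiRb]]] l Ml; apply: Theta_injective.
(* All products [R_d,k^T Theta R_d,l] vanish and the blocks [R_d,k] have jointly
   full row rank. *)
apply: (row_free_coefm_eq0 fR) => k _; rewrite mulmxA.
rewrite -coefm2_congr map_Theta -PsiRb.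
apply: (coefm2_quotient_eq0 (M := M)) => // i j Mj.
by rewrite -PsiE -map_Theta coefm2_congr (coefm_order oR Mj) mulmx0.
Qed.

(** An identity factor gives [J(eta)] the shape that [coefm2_congr] and [bdf_congr] treat. *)
Lemma at_eta_congr n (J : 'M[{poly R}]_n) : at_eta J =
  (at_zeta 1%:M)^T *m map_mx (polyC \o polyC) 1%:M *m at_eta J.
Proof. by rewrite /at_zeta !map_mx1 trmx1 !mul1mx. Qed.

Lemma at_zeta_congr n (J : 'M[{poly R}]_n) : (at_zeta J)^T =
  (at_zeta J)^T *m map_mx (polyC \o polyC) 1%:M *m at_eta 1%:M.
Proof. by rewrite /at_eta !map_mx1 !mulmx1. Qed.

Lemma coefm1 n k : coefm k (1%:M : 'M[{poly R}]_n) = (k == 0%N)%:R%:M.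
Proof.
by apply/matrixP => i j; rewrite !mxE coefMn coef1.
Qed.

Lemma jet_op1 K n (d : nat -> R -> 'cV[R]_n) z : jet_op K.+1 1%:M d z = d 0%N z.
Proof.
rewrite /jet_op big_ord_recl big1 ?addr0; first by rewrite coefm1 mul1mx.
by move=> k _; rewrite coefm1 mul_scalar_mx scale0r.
Qed.

(** Minimality forces full row rank of the coefficients of [T]: they factor the coefficient matrix
    of [Psi], whose rank is the number of rows of [T]. The degree bound then passes from [Psi] to
    [T]. *)
Lemma minimal_factorization_order N n alpha beta (J : 'M[{poly R}]_n)
    (T : 'M[{poly R}]_(alpha + beta, n)) :
  order_le N J -> minimal_factorization J T ->
  forall k, (N <= k)%N -> coefm k T = 0.
Proof.
move=> oJ [Psi [PsiE PsiT rk]] l Nl; apply: Sig_injective.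
(* Cut at the size of [Psi] rather than [T], so that [B^T Sig B] is exactly the coefficient matrix
   of [Psi]. *)
pose B := \mxrow_(k < sizem2 Psi) coefm k T.
have fB : row_free B.
  rewrite /row_free eqn_leq rank_leq_row {1}rk /coef_matrix2.
  have -> : \mxblock_(k < sizem2 Psi, l < sizem2 Psi) coefm2 k l Psi =
      B^T *m Sig alpha beta *m B.
    rewrite /B tr_mxrow mxcol_mul mul_mxcol_mxrow; apply: eq_mxblock => i j.
    by rewrite -coefm2_congr -PsiT.
  exact: mxrankM_maxr.
apply: (row_free_coefm_eq0 fB) => k _; rewrite mulmxA -coefm2_congr -PsiT.
apply: (coefm2_quotient_eq0 (M := N)) => // i j Nj.
rewrite -PsiE coefm2D.
rewrite (at_eta_congr J) (at_zeta_congr J) !coefm2_congr.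
rewrite (coefm_order oJ Nj) mulmx0 add0r coefm1.
(* Here [j > N] is positive, whereas the identity only has a constant coefficient. *)
by case: j Nj => // j _; rewrite mul_mx_scalar scale0r.
Qed.
End Orders.

(** * Reciprocity, the Hamiltonian and the power balance *)

Section Balance.
Context {R : realType} (a b : R).

Section Lagrangian.
Context (M n p : nat) (Rm : 'M[{poly R}]_(n + n, n)) (Rb : 'M[{poly R}]_(p + p, n)).
Context (ab : a <= b) (oR : order_le M Rm) (bR : boundary_polynomial_matrix Rm Rb).
Local Notation P := (jet_op M.+1 (usubmx Rm)).
Local Notation S := (jet_op M.+1 (dsubmx Rm)).
Local Notation Pb := (jet_op M.+1 (usubmx Rb)).
Local Notation Sb := (jet_op M.+1 (dsubmx Rb)).

(** The constant [W] is general in order to serve [Theta] in the reciprocity relation and [Xi] in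
    the Hamiltonian. *)
Lemma coefm2_boundaryr (W : 'M[R]_(p + p)) k l : (M <= l)%N ->
  coefm2 k l ((at_zeta Rb)^T *m map_mx (polyC \o polyC) W *m at_eta Rb) = 0.
Proof.
by move=> Ml; rewrite coefm2_congr (boundary_polynomial_matrix_order oR bR Ml) mulmx0.
Qed.

Lemma coefm2_boundaryl (W : 'M[R]_(p + p)) k l : (M <= k)%N ->
  coefm2 k l ((at_zeta Rb)^T *m map_mx (polyC \o polyC) W *m at_eta Rb) = 0.
Proof.
move=> Mk; rewrite coefm2_congr (boundary_polynomial_matrix_order oR bR Mk).
by rewrite trmx0 !mul0mx.
Qed.

(** The form of [R^T(zeta) Theta R(eta)] is integrated in two ways, directly and as a total
    derivative. Two distinct jets are allowed because solutions at different times get compared. *)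
Lemma reciprocity d1 d2 : is_jet a b M d1 -> is_jet a b M d2 ->
  ipv a b (S d1) (P d2) - ipv a b (P d1) (S d2) =
  bracket a b (fun z => dot (Sb d1 z) (Pb d2 z) - dot (Pb d1 z) (Sb d2 z)).
Proof.
move=> j1 j2; have [_ [Psi [PsiE PsiRb]]] := bR.
apply: (@has_integral_unique _ a b (bdf M.+1 ((zeta + eta) *: Psi) d1 d2)).
  apply: eq_has_integral (has_integralB _ _).
  - by move=> z; rewrite -PsiE -map_Theta bdf_congr Theta_form !usub_jet_op !dsub_jet_op.
  - by apply: has_integral_ipv => i; exact: L2_jet_op.
  - by apply: has_integral_ipv => i; exact: L2_jet_op.
rewrite /bracket -!usub_jet_op -!dsub_jet_op -!Theta_form -!bdf_congr map_Theta -PsiRb.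
by apply: has_integral_bdf => // k l ?; rewrite PsiRb -map_Theta;
  [exact: coefm2_boundaryr|exact: coefm2_boundaryl].
Qed.

(** On the diagonal each [Xi] form is twice a dot product, which cancels the one half inside [H];
    the one half in front of the integral stays. *)
Lemma hamiltonianE f : sobolev a b M f ->
  hamiltonian a b M (hamiltonian_matrix Rm Rb) f =
  2^-1 * (ipv a b (P (wderiv a b M f)) (S (wderiv a b M f)) -
    bracket a b (fun z => dot (Pb (wderiv a b M f) z) (Sb (wderiv a b M f) z))).
Proof.
move=> sf; rewrite /hamiltonian; congr (_ * _); set d := wderiv a b M f.
have jd : is_jet a b M d.
  (* The choice made by [wderiv] is a genuine jet, since [sf] provides one. *)
  by apply: (@sobolev_jet_is_jet _ a b M n f); exact: (xgetPex _ sf).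
suff [_ <-] : has_integral a b (bdf M.+1 (hamiltonian_matrix Rm Rb) d d)
   (ipv a b (P d) (S d) - bracket a b (fun z => dot (Pb d z) (Sb d z))).
  apply: eq_Rintegral => z _; rewrite summxE; apply: eq_bigr => i _.
  by rewrite summxE.
(* The one half is moved next to the boundary form, leaving a pure factor [zeta + eta]. *)
rewrite /hamiltonian_matrix -scalerA -!map_Xi.
apply: eq_has_integral (has_integralB _ _).
- by move=> z; rewrite bdfB.
- apply: (@eq_has_integral _ a b
      (fun z => 2^-1 * (dot (S d z) (P d z) + dot (P d z) (S d z)))).
    by move=> z; rewrite bdfZ bdf_congr Xi_form !usub_jet_op !dsub_jet_op.
  rewrite (_ : ipv _ _ _ _ = 2^-1 * (ipv a b (S d) (P d) + ipv a b (P d) (S d))).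
    apply: has_integralZ; apply: has_integralD;
      by apply: has_integral_ipv => i; exact: L2_jet_op.
  by rewrite (ipvC a b (S d)); field.
set G := _ *m at_eta Rb.
have -> : bracket a b (fun z => dot (Pb d z) (Sb d z)) =
    bdf M.+1 ((2^-1)%:P%:P *: G) d d b - bdf M.+1 ((2^-1)%:P%:P *: G) d d a.
  rewrite !bdfZ !bdf_congr !Xi_form !usub_jet_op !dsub_jet_op /bracket.
  by rewrite !(dotC (Sb d _)); field.
apply: has_integral_bdf => // k l ?; rewrite coefm2Z.
  by rewrite coefm2_boundaryr// scaler0.
by rewrite coefm2_boundaryl// scaler0.
Qed.
End Lagrangian.

(** Twice the integrand [e^T J e] is the form of [J(eta) + J^T(zeta)], hence a total derivative. *)
Lemma skew_adjoint_power N n alpha beta (J : 'M[{poly R}]_n)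
    (T : 'M[{poly R}]_(alpha + beta, n)) d :
  a <= b -> order_le N J -> minimal_factorization J T -> is_jet a b N d ->
  ipv a b (jet_op N.+1 J d) (d 0%N) = 2^-1 * bracket a b
    (fun z => ((jet_op N.+1 T d z)^T *m Sig alpha beta *m jet_op N.+1 T d z) 0 0).
Proof.
move=> ab oJ mf jd; have oT := minimal_factorization_order oJ mf.
case: mf => Psi [PsiE PsiT _].
set JJ := jet_op _ J d.
suff : ipv a b (d 0%N) JJ + ipv a b JJ (d 0%N) =  bracket a b
    (fun z => ((jet_op N.+1 T d z)^T *m Sig alpha beta *m jet_op N.+1 T d z) 0 0).
  by move=> <-; rewrite (ipvC a b (d 0%N)); field.
apply: has_integral_unique.
  apply: has_integralD; apply: has_integral_ipv => i.
  - exact: jd.1.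
  - exact: L2_jet_op.
  - exact: L2_jet_op.
  - exact: jd.1.
apply: (@eq_has_integral _ a b (bdf N.+1 ((zeta + eta) *: Psi) d d)).
  move=> z; rewrite -PsiE (at_eta_congr J) (at_zeta_congr J).
  by rewrite bdfD !bdf_congr !jet_op1 !mulmx1.
rewrite /bracket -!bdf_congr -PsiT.
apply: has_integral_bdf => //; rewrite PsiT => k l kN; rewrite coefm2_congr (oT _ kN).
  by rewrite mulmx0.
by rewrite trmx0 !mul0mx.
Qed.

(** The product is half of [(Tb - Ta)^T Sig (Ta + Tb)], and the cross terms cancel because [Sig] is
    symmetric. *)
Lemma power_ports alpha beta (fb eb Ta Tb : 'cV[R]_(alpha + beta)) :
  col_mx fb eb = (Num.sqrt 2)^-1 *:
    (block_mx (Sig alpha beta) (Sig alpha beta) (- 1%:M) 1%:M *m col_mx Ta Tb) ->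
  (eb^T *m fb) 0 0 = 2^-1 * ((Tb^T *m Sig alpha beta *m Tb) 0 0 -
                             (Ta^T *m Sig alpha beta *m Ta) 0 0).
Proof.
rewrite mul_block_col scale_col_mx => /eq_col_mx[-> ->].
rewrite [(_ *: _)^T]linearZ /= -scalemxAl -scalemxAr scalerA mxE.
rewrite -invfM -expr2 sqr_sqrtr//.
congr (_ * _); rewrite -mulmxDr mulNmx !mul1mx linearD linearN /= mulmxA.
rewrite mulmxDr !mulmxDl !mulNmx.
have D00 (A B : 'M[R]_1) : (A + B) 0 0 = A 0 0 + B 0 0 by rewrite mxE.
have N00 (A : 'M[R]_1) : (- A) 0 0 = - A 0 0 by rewrite mxE.
rewrite !D00 !N00.
have -> : (Tb^T *m Sig alpha beta *m Ta) 0 0 = (Ta^T *m Sig alpha beta *m Tb) 0 0.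
  transitivity ((Tb^T *m Sig alpha beta *m Ta)^T 0 0); first by rewrite [RHS]mxE.
  rewrite !trmx_mul trmxK mulmxA /Sig tr_block_mx linearN /=.
  by rewrite !trmx1 !trmx0.
by ring.
Qed.
End Balance.

(** * Differentiation in time *)

Section Differentiation.
Context {R : realType}.

Lemma cvg_sum_ord (T : Type) (F : set_system T) (FF : Filter F) n
    (f : 'I_n -> T -> R) (l : 'I_n -> R) :
  (forall i, f i s @[s --> F] --> l i) ->
  \sum_i f i s @[s --> F] --> \sum_i l i.
Proof.
move=> fl; apply: cvg_big => // -[x y].
exact: add_continuous.
Qed.

Lemma cvg_addr_dnbhs0 (t : R) : t + h @[h --> 0^'] --> t.
Proof.
apply: cvg_within_filter.
have : t + h @[h --> (0 : R)] --> t + 0 by apply: cvgD; [exact: cvg_cst|exact: cvg_id].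
by rewrite addr0.
Qed.

(** Symmetry turns [B t (t + h)] into [B (t + h) t], so the increment of [B s s] splits into two
    increments of the first argument alone, each contributing the limit [l]. *)
Lemma is_derive_symmetric_form (B : R -> R -> R) (f : R -> R) (t l : R) :
  (\forall s \near t, f s = 2^-1 * B s s) ->
  (\forall s \near t, B s t = B t s) ->
  h^-1 * (B (t + h) (t + h) - B t (t + h)) @[h --> 0^'] --> l ->
  h^-1 * (B (t + h) t - B t t) @[h --> 0^'] --> l ->
  is_derive t 1 f l.
Proof.
move=> fB BC Bl Bm.
have key : h^-1 *: ((f \o shift t) (h *: 1) - f t) @[h --> 0^'] --> l.
  rewrite (_ : l = 2^-1 * (l + l)); last by field.
  have L : 2^-1 * (h^-1 * (B (t + h) (t + h) - B t (t + h)) +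
      h^-1 * (B (t + h) t - B t t)) @[h --> 0^'] --> 2^-1 * (l + l).
    by apply: cvgM; [exact: cvg_cst|exact: cvgD].
   have th : t + h @[h --> 0^'] --> t := @cvg_addr_dnbhs0 t.
  apply: (cvg_trans _ L); apply: near_eq_cvg; near=> h.
  rewrite /= /GRing.scale /= mulr1 (addrC h).
  have -> : f (t + h) = 2^-1 * B (t + h) (t + h) by near: h; exact: th _ fB.
  have -> : f t = 2^-1 * B t t := nbhs_singleton fB.
  have -> : B (t + h) t = B t (t + h) by near: h; exact: th _ BC.
  by ring.
apply: DeriveDef; first by apply/cvg_ex; exists l.
exact/cvg_lim.
Unshelve. all: by end_near.
Qed.

Lemma cvg_dot_quotient p (chi eps : R -> 'cV[R]_p) (w : 'cV[R]_p) (t : R) :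
  (forall i, derivable (fun s => chi s i 0) t 1) ->
  (forall i, eps h i 0 @[h --> 0^'] --> w i 0) ->
  h^-1 * (dot (chi (t + h)) (eps h) - dot (chi t) (eps h)) @[h --> 0^'] -->
    dot (\col_i derive1 (fun s => chi s i 0) t) w.
Proof.
move=> dchi epsw.
have -> : (fun h => h^-1 * (dot (chi (t + h)) (eps h) - dot (chi t) (eps h))) =
    (fun h => \sum_i (h^-1 * (chi (t + h) i 0 - chi t i 0)) * eps h i 0).
  apply/funext => h; rewrite /dot !mxE -sumrB mulr_sumr.
  by apply: eq_bigr => i _; rewrite !mxE -mulrBl mulrA.
rewrite /dot mxE; apply: cvg_sum_ord => i; rewrite !mxE; apply: cvgM => //.
rewrite derive1E.
have -> : (fun h => h^-1 * (chi (t + h) i 0 - chi t i 0)) =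
    (fun h => h^-1 *: (((fun s => chi s i 0) \o shift t) (h *: 1) - chi t i 0)).
  by apply/funext => h; rewrite /= /GRing.scale /= mulr1 (addrC h).
exact: dchi i.
Qed.

Context (a b : R).

Lemma cvg_ipv n (F : set_system R) (FF : Filter F) (u_ v_ : R -> R -> 'cV[R]_n) u v :
  in_L2 a b u -> in_L2 a b v ->
  (\forall s \near F, in_L2 a b (u_ s)) -> (\forall s \near F, in_L2 a b (v_ s)) ->
  L2_cvg a b F u_ u -> L2_cvg a b F v_ v ->
  ipv a b (u_ s) (v_ s) @[s --> F] --> ipv a b u v.
Proof.
move=> uL vL u_L v_L u_u v_v; apply: cvg_sum_ord => i.
apply: cvg_ip (u_u i) (v_v i); [exact: uL|exact: vL|..].
- by apply: filterS u_L => s; exact.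
- by apply: filterS v_L => s; exact.
Qed.

Lemma in_L2_quotient n (f g : R -> 'cV[R]_n) (h : R) :
  in_L2 a b f -> in_L2 a b g -> in_L2 a b (fun z => h^-1 *: (f z - g z)).
Proof.
move=> fL gL i.
suff -> : (fun z => (h^-1 *: (f z - g z)) i 0) = (fun z => h^-1 * (f z i 0 - g z i 0)).
  exact: L2Z (L2B (fL i) (gL i)).
by apply/funext => z; rewrite !mxE.
Qed.

Lemma ipv_quotient n (f g e : R -> 'cV[R]_n) (h : R) :
  in_L2 a b f -> in_L2 a b g -> in_L2 a b e ->
  ipv a b (fun z => h^-1 *: (f z - g z)) e = h^-1 * (ipv a b f e - ipv a b g e).
Proof.
move=> fL gL eL; rewrite /ipv -sumrB mulr_sumr; apply: eq_bigr => i _.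
rewrite -(ipBl (fL i) (gL i) (eL i)) -(ipZl _ (L2B (fL i) (gL i)) (eL i)).
by congr ip; apply/funext => z; rewrite !mxE.
Qed.

End Differentiation.

(** * Port variables of solutions and the energy balance *)

Lemma latent_jet (R : realType) (a b : R) (M n p : nat)
    (Rm : 'M[{poly R}]_(n + n, n)) (Rb : 'M[{poly R}]_(p + p, n))
    (f x e : R -> 'cV[R]_n) (chi eps : R -> 'cV[R]_p) :
  stokes_lagrange_latent a b M Rm Rb f ((x, chi), (e, eps)) ->
  [/\ is_jet a b M (wderiv a b M f),
      ae_eq_on a b x (jet_op M.+1 (usubmx Rm) (wderiv a b M f))
    & ae_eq_on a b e (jet_op M.+1 (dsubmx Rm) (wderiv a b M f))].
Proof.
move=> [_ _ sf xeE _]; split.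
- by apply: (@sobolev_jet_is_jet _ a b M n f); exact: (xgetPex _ sf).
- apply: (@filterS _ _ (ae_filter_ringOfSetsType _) _ _ _ xeE) => z zE zab.
  by rewrite -usub_jet_op -[RHS]/(usubmx (diffop a b M Rm f z)) -zE// col_mxKu.
- apply: (@filterS _ _ (ae_filter_ringOfSetsType _) _ _ _ xeE) => z zE zab.
  by rewrite -dsub_jet_op -[RHS]/(dsubmx (diffop a b M Rm f z)) -zE// col_mxKd.
Qed.

Lemma latent_ipv (R : realType) (a b : R) (M n p : nat)
    (Rm : 'M[{poly R}]_(n + n, n)) (Rb : 'M[{poly R}]_(p + p, n))
    (f1 f2 x1 x2 e1 e2 : R -> 'cV[R]_n) (chi1 chi2 eps1 eps2 : R -> 'cV[R]_p) :
  stokes_lagrange_latent a b M Rm Rb f1 ((x1, chi1), (e1, eps1)) ->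
  stokes_lagrange_latent a b M Rm Rb f2 ((x2, chi2), (e2, eps2)) ->
  ipv a b x1 e2 = ipv a b (jet_op M.+1 (usubmx Rm) (wderiv a b M f1))
                          (jet_op M.+1 (dsubmx Rm) (wderiv a b M f2)).
Proof.
move=> L1 L2; have [j1 x1E _] := latent_jet L1; have [j2 _ e2E] := latent_jet L2.
case: L1 L2 => [x1L _ _ _ _] [_ e2L _ _ _].
by apply: ipv_ae => // i; exact: L2_jet_op.
Qed.

(** With [x], [chi] taken at time [s] and [e], [eps] at time [s'], this is the form [B(s, s')]. *)
Definition port_form (R : realType) (a b : R) n p (x e : R -> 'cV[R]_n)
    (chi eps : R -> 'cV[R]_p) : R :=
  ipv a b x e - bracket a b (fun z => dot (chi z) (eps z)).

Lemma port_form_sym (R : realType) (a b : R) (M n p : nat)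
    (Rm : 'M[{poly R}]_(n + n, n)) (Rb : 'M[{poly R}]_(p + p, n))
    (f1 f2 x1 x2 e1 e2 : R -> 'cV[R]_n) (chi1 chi2 eps1 eps2 : R -> 'cV[R]_p) :
  a <= b -> order_le M Rm -> boundary_polynomial_matrix Rm Rb ->
  stokes_lagrange_latent a b M Rm Rb f1 ((x1, chi1), (e1, eps1)) ->
  stokes_lagrange_latent a b M Rm Rb f2 ((x2, chi2), (e2, eps2)) ->
  port_form a b x1 e2 chi1 eps2 = port_form a b x2 e1 chi2 eps1.
Proof.
move=> ab oR bR L1 L2; rewrite /port_form (latent_ipv L1 L2) (latent_ipv L2 L1).
have [j1 _ _] := latent_jet L1; have [j2 _ _] := latent_jet L2.
have := reciprocity ab oR bR j1 j2; rewrite /bracket.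
case: L1 L2 => [_ _ _ _ p1] [_ _ _ _ p2].
have [-> ->] := p1 _ (or_introl erefl); have [-> ->] := p1 _ (or_intror erefl).
have [-> ->] := p2 _ (or_introl erefl); have [-> ->] := p2 _ (or_intror erefl).
rewrite -![diffop a b M _ _ _]/(jet_op _ _ _ _).
rewrite (ipvC a b (jet_op _ (dsubmx Rm) _)).
rewrite (dotC (jet_op _ (dsubmx Rb) _ a)) (dotC (jet_op _ (dsubmx Rb) _ b)).
lra.
Qed.

(** The latent variable disappears: the energy is expressed by port variables, whose regularity in
    time is what the system prescribes. *)
Lemma hamiltonian_port_form (R : realType) (a b : R) (M n p : nat)
    (Rm : 'M[{poly R}]_(n + n, n)) (Rb : 'M[{poly R}]_(p + p, n))
    (f x e : R -> 'cV[R]_n) (chi eps : R -> 'cV[R]_p) :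
  a <= b -> order_le M Rm -> boundary_polynomial_matrix Rm Rb ->
  stokes_lagrange_latent a b M Rm Rb f ((x, chi), (e, eps)) ->
  hamiltonian a b M (hamiltonian_matrix Rm Rb) f = 2^-1 * port_form a b x e chi eps.
Proof.
move=> ab oR bR L; have [_ _ sf _ pE] := L.
rewrite (hamiltonianE ab oR bR sf) /port_form (latent_ipv L L) /bracket.
have [-> ->] := pE _ (or_introl erefl).
by have [-> ->] := pE _ (or_intror erefl).
Qed.

Lemma stokes_dirac_power (R : realType) (a b : R) (N n alpha beta : nat)
    (J : 'M[{poly R}]_n) (T : 'M[{poly R}]_(alpha + beta, n))
    (f e : R -> 'cV[R]_n) (fb eb : 'cV[R]_(alpha + beta)) :
  a <= b -> order_le N J -> minimal_factorization J T ->
  stokes_dirac a b N J T ((f, fb), (e, eb)) ->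
  ipv a b f e = (eb^T *m fb) 0 0.
Proof.
move=> ab oJ mf [fL eL se fE ports]; rewrite (power_ports ports).
have sj : sobolev_jet a b N e (wderiv a b N e) by exact: (xgetPex _ se).
have j := sobolev_jet_is_jet sj.
rewrite -[RHS](skew_adjoint_power ab oJ mf j); apply: ipv_ae => //.
- by move=> i; exact: L2_jet_op.
- by move=> i; exact: j.1.
- by case: sj.
Qed.

Theorem proposition28 (R : realType) (a b : R) (n p M N alpha beta : nat)
    (Rm : 'M[{poly R}]_(n + n, n)) (Rb : 'M[{poly R}]_(p + p, n))
    (J : 'M[{poly R}]_n) (T : 'M[{poly R}]_(alpha + beta, n))
    (I : set R) (x e xi : R -> R -> 'cV[R]_n)
    (chi eps : R -> R -> 'cV[R]_p)
    (fb eb : R -> 'cV[R]_(alpha + beta)) :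
  a < b ->
  order_le M Rm -> maximally_reciprocal a b Rm ->
  boundary_polynomial_matrix Rm Rb ->
  order_le N J -> skew_adjoint J -> minimal_factorization J T ->
  open I ->
  boundary_phs a b M N Rm Rb J T I x e chi eps fb eb ->
  (forall t, I t ->
     stokes_lagrange_latent a b M Rm Rb (xi t)
       ((x t, chi t), (e t, eps t))) ->
  forall t, I t ->
    is_derive t 1
      (fun s => hamiltonian a b M (hamiltonian_matrix Rm Rb) (xi s))
      (((eb t)^T *m fb t) 0 0
       - bracket a b (fun z => ((eps t z)^T *m dtime chi t z) 0 0)).
Proof.
move=> /ltW ab oR _ bR oJ _ mf oI phs lat t It.
have [[dx xdx sd] _ ecvg ports] := phs t It.
have nI : \forall s \near t, I s by exact: open_nbhs_nbhs.
have xL s : I s -> in_L2 a b (x s) by move=> /lat[].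
have eL s : I s -> in_L2 a b (e s) by move=> /lat[].
have dxL : in_L2 a b dx by case: sd.
have tI : \forall h \near 0^', I (t + h) by exact: (@cvg_addr_dnbhs0 R t) _ nI.
(* Both increments of the first argument are instances of this claim, with [e'], [eps'] either
   following the trajectory at [t + h] or frozen at [t]. *)
have quotient (e' : R -> R -> 'cV[R]_n) (eps' : R -> R -> 'cV[R]_p) :
    (\forall h \near 0^', in_L2 a b (e' h)) ->
    L2_cvg a b 0^' e' (e t) ->
    (forall z, z = a \/ z = b -> forall i, eps' h z i 0 @[h --> 0^'] --> eps t z i 0) ->
    h^-1 * (port_form a b (x (t + h)) (e' h) (chi (t + h)) (eps' h) -
            port_form a b (x t) (e' h) (chi t) (eps' h)) @[h --> 0^'] -->
    ((eb t)^T *m fb t) 0 0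
       - bracket a b (fun z => ((eps t z)^T *m dtime chi t z) 0 0).
  move=> e'L e'e eps'eps.
  have dotz z : z = a \/ z = b ->
      h^-1 * (dot (chi (t + h) z) (eps' h z) - dot (chi t z) (eps' h z)) @[h --> 0^']
      --> dot (eps t z) (dtime chi t z).
    move=> zab; rewrite dotC; apply: cvg_dot_quotient => i; last exact: eps'eps.
    exact: (ports z zab i).1.
  (* By linearity in the first argument the quotient acts on [x] and [chi], where it converges in
     the mean and at the endpoints respectively. *)
  have L : ipv a b (fun z => h^-1 *: (x (t + h) z - x t z)) (e' h) -
      (h^-1 * (dot (chi (t + h) b) (eps' h b) - dot (chi t b) (eps' h b)) -
       h^-1 * (dot (chi (t + h) a) (eps' h a) - dot (chi t a) (eps' h a)))
      @[h --> 0^'] --> ipv a b dx (e t) -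
      (dot (eps t b) (dtime chi t b) - dot (eps t a) (dtime chi t a)).
    apply: cvgB; last by apply: cvgB; apply: dotz; [right|left].
    apply: cvg_ipv => //; first exact: eL.
    by apply: filterS tI => h Ith; apply: in_L2_quotient; exact: xL.
  (* The port power in the target is traded for the integral of [dx^T e]. *)
  rewrite -(stokes_dirac_power ab oJ mf sd).
  apply: (cvg_trans _ L); apply: near_eq_cvg; near=> h.
  have Ith : I (t + h) by near: h.
  have e'hL : in_L2 a b (e' h) by near: h.
  rewrite /= ipv_quotient//; [|exact: xL|exact: xL].
  by rewrite /port_form /bracket; ring.
apply: (@is_derive_symmetric_form _
  (fun s s' => port_form a b (x s) (e s') (chi s) (eps s'))).
- by apply: filterS nI => s Is; exact: hamiltonian_port_form (lat s Is).
- by apply: filterS nI => s Is; exact: port_form_sym (lat s Is) (lat t It).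
- apply: (quotient (fun h => e (t + h)) (fun h => eps (t + h))).
  + by apply: filterS tI => h; exact: eL.
  + move=> i; exact: (cvg_comp _ _ (@cvg_addr_dnbhs0 R t) (ecvg i)).
  + move=> z zab i; exact: (cvg_comp _ _ (@cvg_addr_dnbhs0 R t) (ports z zab i).2).
- apply: (quotient (fun=> e t) (fun=> eps t)).
  + by apply: filterE => h; exact: eL.
  + move=> i; suff -> : EFin \o (fun z => e t z i 0 - e t z i 0) \_ `[a, b] = cst 0%E.
      by rewrite Lnorm0//; exact: cvg_cst.
    by apply/funext => z; rewrite /= patchE subrr; case: ifPn.
  + move=> z zab i; exact: cvg_cst.
Unshelve. all: by end_near.
Qed.
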